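(* Let $n \ge 1$ be an integer and let $\mathcal{A}_n$ be the universal unital C*-algebra generated by $n$ projections $P_1, P_2, \dots, P_n$. Then there are isomorphisms of C*-algebras $$\mathcal{A}_n \;\cong\; C^*(\mathbb{Z}_2)^{\star n} \;\cong\; C^*(F_{n-1}) \rtimes \mathbb{Z}_2,$$ where $C^*(\mathbb{Z}_2)^{\star n}$ is the (unital) free product of $n$ copies of the group C*-algebra of $\mathbb{Z}_2$, and $C^*(F_{n-1}) \rtimes \mathbb{Z}_2$ is the crossed product of the group C*-algebra of the free group $F_{n-1}$ on $n-1$ generators with respect to the $\mathbb{Z}_2$-action that sends each of the $n-1$ free generators to its inverse.
   Context: All C*-algebras are complex and unital. A projection is an element $P$ with $P = P^* = P^2$. The algebra $\mathcal{A}_n$ is characterized by its universal property: it is a unital C*-algebra generated (as a unital C*-algebra) by projections $P_1,\dots,P_n$, with no further relations imposed, such that for any unital C*-algebra $B$ and any projections $p_1,\dots,p_n \in B$ there is a unique unital $*$-homomorphism $\mathcal{A}_n \to B$ with $P_i \mapsto p_i$ for all $i$. $\mathbb{Z}_2 = \mathbb{Z}/2\mathbb{Z}$. For a discrete group $G$, $C^*(G)$ is the full (universal) group C*-algebra. The free product is the universal free product of unital C*-algebras, i.e. their coproduct in the category of unital C*-algebras with unital $*$-homomorphisms. $F_{n-1}$ is the free group on $n-1$ generators ($F_0$ is trivial). The $\mathbb{Z}_2$-action on $C^*(F_{n-1})$ is the one induced by the order-two automorphism of $F_{n-1}$ sending each free generator to its inverse, and the crossed product is the full (universal) one. *)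

(* Defs.v *)
From HB Require Import structures.
From mathcomp Require Import all_boot all_order all_fingroup all_algebra.
From mathcomp Require Import complex.
From mathcomp Require Import boolp classical_sets reals topology normedtype.

Set Implicit Arguments.
Unset Strict Implicit.
Unset Printing Implicit Defensive.

Import Order.TTheory GRing.Theory Num.Theory.
Import numFieldNormedType.Exports.

Local Open Scope classical_set_scope.
Local Open Scope complex_scope.
Local Open Scope ring_scope.

(* The complex numbers are R[i] for R : realType. The norm of a normed module
   over R[i] is valued in R[i] (in its nonnegative reals), so norm identities
   and inequalities are written in R[i].
   Hierarchy Builder refuses a structure that joins rings with normed modules,
   so the product and the unit are fields of the mixin, from which the ring
   structure is derived below. The zero algebra (1 = 0) is allowed. *)
HB.mixin Record isUnitalCStarAlgebra (R : realType) (A : Type)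
  of CompleteNormedModule R[i] A := {
  cstar_one : A;
  cstar_mul : A -> A -> A;
  star : A -> A;
  cstar_mulA : associative cstar_mul;
  cstar_mul1l : left_id cstar_one cstar_mul;
  cstar_mul1r : right_id cstar_one cstar_mul;
  cstar_mulDl : left_distributive cstar_mul +%R;
  cstar_mulDr : right_distributive cstar_mul +%R;
  cstar_scalerAl : forall (k : R[i]) (x y : A),
    k *: cstar_mul x y = cstar_mul (k *: x) y;
  cstar_scalerAr : forall (k : R[i]) (x y : A),
    k *: cstar_mul x y = cstar_mul x (k *: y);
  cstar_ler_normM : forall x y : A, `|cstar_mul x y| <= `|x| * `|y|;
  starK : involutive star;
  starD : {morph star : x y / x + y};
  starZ : forall (k : R[i]) (x : A), star (k *: x) = k^* *: star x;
  starM : forall x y : A, star (cstar_mul x y) = cstar_mul (star y) (star x);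
  cstar_identity : forall x : A, `|cstar_mul (star x) x| = `|x| ^+ 2
}.

#[short(type="cstarAlgType")]
HB.structure Definition UnitalCStarAlgebra (R : realType) :=
  {A of CompleteNormedModule R[i] A & isUnitalCStarAlgebra R A}.

HB.instance Definition _ (R : realType) (A : cstarAlgType R) :=
  GRing.Zmodule_isPzRing.Build A (@cstar_mulA R A) (@cstar_mul1l R A)
    (@cstar_mul1r R A) (@cstar_mulDl R A) (@cstar_mulDr R A).

Section CStar.
Variable R : realType.
Implicit Types A B E : cstarAlgType R.

Definition is_projection A (p : A) : Prop := star p = p /\ p * p = p.

Definition cstar_unitary A (u : A) : Prop := star u * u = 1 /\ u * star u = 1.

Definition unital_star_hom A B (f : A -> B) : Prop :=
  [/\ linear f, f 1 = 1, {morph f : x y / x * y}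
    & {morph f : x / star x}].

Definition cstar_isomorphic A B : Prop :=
  exists2 f : A -> B, unital_star_hom f & bijective f.

Definition unital_cstar_subalgebra A (D : set A) : Prop :=
  [/\ closed D, D 1,
      forall (k : R[i]) (x y : A), D x -> D y -> D (k *: x + y),
      forall x y : A, D x -> D y -> D (x * y)
    & forall x : A, D x -> D (star x)].

Definition generates_cstar A (S : set A) : Prop :=
  forall D : set A, unital_cstar_subalgebra D -> S `<=` D -> D = setT.

Definition universal_projections n A (P : 'I_n -> A) : Prop :=
  [/\ forall i, is_projection (P i),
      generates_cstar (range P)
    & forall (B : cstarAlgType R) (p : 'I_n -> B),
        (forall i, is_projection (p i)) ->
        exists! f : A -> B, unital_star_hom f /\ forall i, f (P i) = p i].

Definition unitary_rep (G : groupType) B (u : G -> B) : Prop :=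
  [/\ forall g, cstar_unitary (u g), u 1%g = 1
    & forall g h, u (g * h)%g = u g * u h].

(* (A, u) is the full group C*-algebra of the discrete group G, together with
   its canonical unitaries *)
Definition full_group_cstar (G : groupType) A (u : G -> A) : Prop :=
  unitary_rep u /\
  forall (B : cstarAlgType R) (v : G -> B), unitary_rep v ->
    exists! f : A -> B, unital_star_hom f /\ forall g, f (u g) = v g.

Definition cstar_free_product (I : Type) (A : I -> cstarAlgType R) E
    (iota : forall i, A i -> E) : Prop :=
  (forall i, unital_star_hom (iota i)) /\
  forall (B : cstarAlgType R) (f : forall i, A i -> B),
    (forall i, unital_star_hom (f i)) ->
    exists! h : E -> B,
      unital_star_hom h /\ forall i (a : A i), h (iota i a) = f i a.

Definition cstar_action (G : groupType) A (alpha : G -> A -> A) : Prop :=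
  [/\ forall g, unital_star_hom (alpha g), alpha 1%g =1 id
    & forall g h, alpha (g * h)%g =1 alpha g \o alpha h].

Definition covariant_rep (G : groupType) A (alpha : G -> A -> A) B
    (pi : A -> B) (u : G -> B) : Prop :=
  [/\ unital_star_hom pi, unitary_rep u
    & forall g a, u g * pi a * star (u g) = pi (alpha g a)].

(* For A unital and G discrete, the full crossed product is the unital
   C*-algebra carrying the universal covariant representation. *)
Definition full_crossed_product (G : groupType) A (alpha : G -> A -> A) E
    (jA : A -> E) (jG : G -> E) : Prop :=
  covariant_rep alpha jA jG /\
  forall (B : cstarAlgType R) (pi : A -> B) (u : G -> B),
    covariant_rep alpha pi u ->
    exists! f : E -> B,
      [/\ unital_star_hom f, forall a, f (jA a) = pi a
        & forall g, f (jG g) = u g].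

End CStar.

Arguments cstar_free_product {R I} A {E} iota.

Definition group_hom (G H : groupType) (f : G -> H) : Prop :=
  {morph f : g h / (g * h)%g}.

Definition free_group_on (I : Type) (F : groupType) (x : I -> F) : Prop :=
  forall (H : groupType) (y : I -> H),
    exists! f : F -> H, group_hom f /\ forall i, f (x i) = y i.

Definition generator_inversion (I : Type) (F : groupType) (x : I -> F)
    (theta : F -> F) : Prop :=
  [/\ group_hom theta, involutive theta
    & forall i, theta (x i) = ((x i)^-1)%g].

(* alpha is the action of Z/2 on the group C*-algebra (CF, u) of F induced by
   the automorphism theta of F. 'Z_2 is the group of residues under addition,
   with neutral element 1%g = 0; Zp1 is the nontrivial element. *)
Definition induced_Z2_action (R : realType) (F : groupType)
    (CF : cstarAlgType R) (u : F -> CF) (theta : F -> F)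
    (alpha : 'Z_2 -> CF -> CF) : Prop :=
  cstar_action alpha /\ forall g, alpha Zp1 (u g) = u (theta g).

(* Main.v *)
(** The three algebras represent the same functor: unital star-homomorphisms
    into B correspond to n-tuples of symmetries (self-adjoint unitaries) of B.
    For A_n, a projection p corresponds to the symmetry 1 - 2p.  For the free
    product, a representation of Z/2 is the choice of one symmetry.  For the
    crossed product, symmetries s_0, ..., s_(n-1) correspond to the covariant
    pair sending the generator of Z/2 to s_0 and the i-th free generator to
    s_i s_0: conjugation by s_0 inverts s_i s_0. *)
From HB Require Import structures.
Require Import Defs.
From mathcomp Require Import all_boot all_fingroup all_algebra complex.
From mathcomp Require Import boolp reals.

Set Implicit Arguments.
Unset Strict Implicit.
Unset Printing Implicit Defensive.

Import GRing.Theory Num.Theory.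

Local Open Scope ring_scope.

(** * Star-algebra identities, unital star-homomorphisms and unitaries *)

Section StarAlgebra.
Variable R : realType.
Implicit Types A B C : cstarAlgType R.

Lemma star_mul A (a b : A) : star (a * b) = star b * star a.
Proof. exact: starM. Qed.

Lemma star1 A : star (1 : A) = 1.
Proof. by rewrite -[LHS]mul1r -{1}(starK (1 : A)) -star_mul mul1r starK. Qed.

Lemma starB A (a b : A) : star (a - b) = star a - star b.
Proof. by rewrite starD -[- b]scaleN1r starZ rmorphN1 scaleN1r. Qed.

Lemma mulrZl A (k : R[i]) (a b : A) : (k *: a) * b = k *: (a * b).
Proof. by symmetry; exact: cstar_scalerAl. Qed.

Lemma mulrZr A (k : R[i]) (a b : A) : a * (k *: b) = k *: (a * b).
Proof. by symmetry; exact: cstar_scalerAr. Qed.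

Section StarHom.
Variables (A B : cstarAlgType R) (f : A -> B).
Hypothesis hf : unital_star_hom f.

Lemma star_homD a b : f (a + b) = f a + f b.
Proof. by case: hf => fL _ _ _; rewrite -[a]scale1r fL !scale1r. Qed.

Lemma star_hom0 : f 0 = 0.
Proof. by apply: (addrI (f 0)); rewrite -star_homD !addr0. Qed.

Lemma star_homZ k a : f (k *: a) = k *: f a.
Proof. by case: hf => fL _ _ _; rewrite -[k *: a]addr0 fL star_hom0 addr0. Qed.

Lemma star_homB a b : f (a - b) = f a - f b.
Proof. by rewrite star_homD -[- b]scaleN1r star_homZ scaleN1r. Qed.

Lemma star_hom1 : f 1 = 1. Proof. by case: hf. Qed.

Lemma star_homM a b : f (a * b) = f a * f b. Proof. by case: hf. Qed.

Lemma star_hom_star a : f (star a) = star (f a). Proof. by case: hf. Qed.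

End StarHom.

Lemma unital_star_hom_id A : unital_star_hom (@id A).
Proof. by []. Qed.

Lemma unital_star_hom_comp A B C (g : B -> C) (f : A -> B) :
  unital_star_hom g -> unital_star_hom f -> unital_star_hom (g \o f).
Proof.
move=> hg hf; split=> [k a b||a b|a] /=.
- by rewrite (star_homD hf) (star_homZ hf) (star_homD hg) (star_homZ hg).
- by rewrite (star_hom1 hf) (star_hom1 hg).
- by rewrite (star_homM hf) (star_homM hg).
- by rewrite (star_hom_star hf) (star_hom_star hg).
Qed.

Lemma cstar_unitary1 A : cstar_unitary (1 : A).
Proof. by rewrite /cstar_unitary star1 mul1r. Qed.

Lemma cstar_unitaryM A (a b : A) :
  cstar_unitary a -> cstar_unitary b -> cstar_unitary (a * b).
Proof.
move=> [a1 a2] [b1 b2]; rewrite /cstar_unitary star_mul.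
split; first by rewrite mulrA -(mulrA (star b)) a1 mulr1.
by rewrite mulrA -(mulrA a) b2 mulr1.
Qed.

Lemma cstar_unitary_star A (a : A) : cstar_unitary a -> cstar_unitary (star a).
Proof. by case=> a1 a2; rewrite /cstar_unitary starK. Qed.

Lemma star_hom_unitary A B (f : A -> B) (a : A) :
  unital_star_hom f -> cstar_unitary a -> cstar_unitary (f a).
Proof.
move=> hf [a1 a2].
by split; rewrite -(star_hom_star hf) -(star_homM hf) ?a1 ?a2 (star_hom1 hf).
Qed.

End StarAlgebra.

(** * The group of unitaries of a C*-algebra *)

Section UnitaryGroup.
Variables (R : realType) (A : cstarAlgType R).

(** The universal property of [free_group_on] speaks of groups only; this subtype is the target that
    turns homomorphisms into unitary representations. With a boolean predicate, [val_inj] reduces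
    the group laws to identities in [A]. *)
Definition unitary_group : Type := {a : A | `[< cstar_unitary a >]}.

HB.instance Definition _ := Choice.on unitary_group.

Implicit Types a b : unitary_group.

Lemma unitary_groupP a : cstar_unitary (val a).
Proof. exact/asboolP/(valP a). Qed.

Definition to_unitary (a : A) (ha : cstar_unitary a) : unitary_group :=
  exist _ a (asboolT ha).

Definition unitary_one : unitary_group := to_unitary (cstar_unitary1 A).

Definition unitary_mul a b : unitary_group :=
  to_unitary (cstar_unitaryM (unitary_groupP a) (unitary_groupP b)).

Definition unitary_inv a : unitary_group :=
  to_unitary (cstar_unitary_star (unitary_groupP a)).

Lemma unitary_mulA : associative unitary_mul.
Proof. by move=> a b c; apply: val_inj; rewrite /= mulrA. Qed.

Lemma unitary_mul1l : left_id unitary_one unitary_mul.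
Proof. by move=> a; apply: val_inj; rewrite /= mul1r. Qed.

Lemma unitary_mul1r : right_id unitary_one unitary_mul.
Proof. by move=> a; apply: val_inj; rewrite /= mulr1. Qed.

Lemma unitary_mulVl : left_inverse unitary_one unitary_inv unitary_mul.
Proof. by move=> a; apply: val_inj => /=; case: (unitary_groupP a). Qed.

Lemma unitary_mulVr : right_inverse unitary_one unitary_inv unitary_mul.
Proof. by move=> a; apply: val_inj => /=; case: (unitary_groupP a). Qed.

HB.instance Definition _ := isGroup.Build unitary_group unitary_mulA
  unitary_mul1l unitary_mul1r unitary_mulVl unitary_mulVr.

End UnitaryGroup.

(** * Universal families of symmetries *)

Section Symmetry.
Variable R : realType.
Implicit Types A B : cstarAlgType R.

Definition symmetry A (s : A) : Prop := star s = s /\ s * s = 1.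

Lemma symmetry_unitary A (s : A) : symmetry s -> cstar_unitary s.
Proof. by case=> sS ss; rewrite /cstar_unitary sS. Qed.

Lemma star_hom_symmetry A B (f : A -> B) (s : A) :
  unital_star_hom f -> symmetry s -> symmetry (f s).
Proof.
move=> hf [sS ss]; split; first by rewrite -(star_hom_star hf) sS.
by rewrite -(star_homM hf) ss (star_hom1 hf).
Qed.

(** The index type is arbitrary: [unit] serves for one copy of Z/2, ['I_n] for the free product, and
    an option type for the crossed product. *)
Definition universal_symmetries (I : Type) A (S : I -> A) : Prop :=
  (forall i, symmetry (S i)) /\
  forall B (s : I -> B), (forall i, symmetry (s i)) ->
    exists! f : A -> B, unital_star_hom f /\ forall i, f (S i) = s i.

Lemma universal_symmetries_hom (I : Type) A (S : I -> A) B (s : I -> B) :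
  universal_symmetries S -> (forall i, symmetry (s i)) ->
  exists2 f : A -> B, unital_star_hom f & forall i, f (S i) = s i.
Proof. by case=> _ hS /hS[f [[]]]; exists f. Qed.

Lemma universal_symmetries_ext (I : Type) A (S : I -> A) B (f g : A -> B) :
  universal_symmetries S -> unital_star_hom f -> unital_star_hom g ->
  (forall i, f (S i) = g (S i)) -> f = g.
Proof.
case=> symS hS hf hg fg.
have [h [_ hu]] := hS _ _ (fun i => star_hom_symmetry hg (symS i)).
by transitivity h; [symmetry|]; apply: hu.
Qed.

Lemma universal_symmetries_reindex (I J : Type) (h : J -> I) A (S : I -> A) :
  bijective h -> universal_symmetries S -> universal_symmetries (S \o h).
Proof.
move=> [k hk kh] hS; split=> [j|B s hs]; first exact: (proj1 hS).
have [f hf fS] := universal_symmetries_hom hS (fun i => hs (k i)).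
exists f; split=> [|g [hg gS]].
  by split=> // j; rewrite /= fS hk.
apply: (universal_symmetries_ext hS hf hg) => i.
by rewrite -(kh i) fS hk; symmetry; exact: gS.
Qed.

(** Each family induces a map to the other algebra; both composites fix a universal family, so they
    are identities by uniqueness. *)
Lemma universal_symmetries_isomorphic (I : Type) A B (S : I -> A) (T : I -> B) :
  universal_symmetries S -> universal_symmetries T -> cstar_isomorphic A B.
Proof.
move=> hS hT.
have [f hf fS] := universal_symmetries_hom hS (proj1 hT).
have [g hg gT] := universal_symmetries_hom hT (proj1 hS).
exists f => //; exists g => [a|b].
- suff /(congr1 (@^~ a)) : g \o f = id by [].
  apply: (universal_symmetries_ext hS) => [||i /=]; last by rewrite fS gT.
    exact: unital_star_hom_comp.
  exact: unital_star_hom_id.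
- suff /(congr1 (@^~ b)) : f \o g = id by [].
  apply: (universal_symmetries_ext hT) => [||i /=]; last by rewrite gT fS.
    exact: unital_star_hom_comp.
  exact: unital_star_hom_id.
Qed.

End Symmetry.

(** * The correspondence between projections and symmetries *)

Section Projections.
Variable R : realType.
Implicit Types A B : cstarAlgType R.

Definition proj_symmetry A (p : A) : A := 1 - (p + p).

Definition symmetry_proj A (s : A) : A := 2^-1 *: (1 - s).

Lemma half_add A (a : A) : (2^-1 : R[i]) *: a + (2^-1 : R[i]) *: a = a.
Proof.
by rewrite -scalerDl -mulr2n -(mulr_natl 2^-1) mulfV ?pnatr_eq0// scale1r.
Qed.

Lemma proj_symmetryK A : cancel (@proj_symmetry A) (@symmetry_proj A).
Proof.
move=> p; rewrite /symmetry_proj /proj_symmetry subKr scalerDr.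
exact: half_add.
Qed.

Lemma symmetry_projK A : cancel (@symmetry_proj A) (@proj_symmetry A).
Proof. by move=> s; rewrite /proj_symmetry half_add subKr. Qed.

Lemma proj_symmetryP A (p : A) : is_projection p -> symmetry (proj_symmetry p).
Proof.
move=> [pS pp]; rewrite /symmetry /proj_symmetry; split.
  by rewrite starB star1 starD pS.
have qq : (p + p) * (p + p) = (p + p) + (p + p) by rewrite mulrDl mulrDr pp.
by rewrite mulrBr mulr1 mulrBl mul1r qq opprB addrK addrNK.
Qed.

Lemma symmetry_projP A (s : A) : symmetry s -> is_projection (symmetry_proj s).
Proof.
move=> [sS ss]; rewrite /is_projection /symmetry_proj; split.
  by rewrite starZ starB star1 sS rmorphV ?unitfE ?pnatr_eq0// rmorph_nat.
rewrite mulrZl mulrZr; congr (_ *: _).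
(* From [s * s = 1], the square of [1 - s] is twice [1 - s], which the remaining factor one half
   cancels. *)
rewrite mulrBr mulr1 mulrBl mul1r ss -[s - 1]opprB opprK scalerDr.
exact: half_add.
Qed.

Lemma star_hom_proj_symmetry A B (f : A -> B) (p : A) :
  unital_star_hom f -> f (proj_symmetry p) = proj_symmetry (f p).
Proof. by move=> hf; rewrite (star_homB hf) (star_hom1 hf) (star_homD hf). Qed.

(** The substitution is bijective and commutes with star-homomorphisms, so it carries one universal
    property to the other. *)
Lemma universal_projections_symmetries n A (P : 'I_n -> A) :
  universal_projections P -> universal_symmetries (@proj_symmetry A \o P).
Proof.
move=> [projP _ hP]; split=> [i|B s hs]; first exact: proj_symmetryP.
have [f [[hf fP] fu]] := hP _ _ (fun i => symmetry_projP (hs i)).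
exists f; split=> [|g [hg gP]].
  by split=> // i /=; rewrite star_hom_proj_symmetry// fP symmetry_projK.
apply: fu; split=> // i.
by rewrite -gP /= star_hom_proj_symmetry// proj_symmetryK.
Qed.

End Projections.

(** * Representations of Z/2 and of free groups, and free products *)

Lemma Z2_cases (g : 'Z_2) : g = 1%g \/ g = Zp1.
Proof.
by case: g => -[|[|//]] ?; [left|right]; apply: val_inj.
Qed.

Lemma Zp1_mulgg : (Zp1 * Zp1)%g = 1%g :> 'Z_2.
Proof. exact: val_inj. Qed.

Section Groups.
Variable R : realType.
Implicit Types A B E : cstarAlgType R.

Lemma unitary_repV (G : groupType) A (u : G -> A) g :
  unitary_rep u -> u (g^-1)%g = star (u g).
Proof.
move=> [uU u1 uM]; have [ug _] := uU g.
by rewrite -[LHS]mul1r -ug -mulrA -uM mulgV u1 mulr1.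
Qed.

Lemma star_hom_unitary_rep (G : groupType) A B (f : A -> B) (u : G -> A) :
  unital_star_hom f -> unitary_rep u -> unitary_rep (f \o u).
Proof.
move=> hf [uU u1 uM]; split=> [g||g h] /=.
- exact: star_hom_unitary.
- by rewrite u1 (star_hom1 hf).
- by rewrite uM (star_homM hf).
Qed.

Lemma full_group_cstar_ext (G : groupType) A (u : G -> A) B (f g : A -> B) :
  full_group_cstar u -> unital_star_hom f -> unital_star_hom g ->
  (forall x, f (u x) = g (u x)) -> f = g.
Proof.
case=> ru hu hf hg fg.
have [h [_ hun]] := hu _ _ (star_hom_unitary_rep hg ru).
by transitivity h; [symmetry|]; apply: hun.
Qed.

(** [Zp1] is its own inverse, and a unitary representation turns inverses into adjoints. *)
Lemma unitary_rep_symmetry A (u : 'Z_2 -> A) :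
  unitary_rep u -> symmetry (u Zp1).
Proof.
move=> ru; rewrite /symmetry -(unitary_repV _ ru).
have -> : (Zp1^-1)%g = Zp1 :> 'Z_2 by exact: val_inj.
by case: ru => _ u1 <-; rewrite Zp1_mulgg u1.
Qed.

Definition symmetry_rep A (s : A) (g : 'Z_2) : A := if g == 1%g then 1 else s.

Lemma symmetry_repP A (s : A) : symmetry s -> unitary_rep (symmetry_rep s).
Proof.
move=> hs; split=> [g||g h]; rewrite /symmetry_rep.
- by case: eqP => _; [exact: cstar_unitary1|exact: symmetry_unitary].
- by rewrite eqxx.
- have [-> | ->] := Z2_cases g; first by rewrite mul1g eqxx mul1r.
  have [-> | ->] := Z2_cases h; first by rewrite mulg1 eqxx mulr1.
  by rewrite Zp1_mulgg eqxx; case: hs.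
Qed.

Lemma unitary_rep_Z2_ext A (u v : 'Z_2 -> A) :
  unitary_rep u -> unitary_rep v -> u Zp1 = v Zp1 -> u =1 v.
Proof.
move=> [_ u1 _] [_ v1 _] uv g.
by have [->|->] := Z2_cases g; rewrite ?u1 ?v1.
Qed.

Lemma full_group_cstar_Z2_symmetry A (z : 'Z_2 -> A) :
  full_group_cstar z -> universal_symmetries (fun _ : unit => z Zp1).
Proof.
move=> hz; have [rz hzu] := hz.
split=> [_|B s hs]; first exact: unitary_rep_symmetry.
have [f [[hf fz] _]] := hzu _ _ (symmetry_repP (hs tt)).
exists f; split=> [|g [hg gz]]; first by split=> // -[]; rewrite fz.
apply: (full_group_cstar_ext hz hf hg).
apply: unitary_rep_Z2_ext; try exact: star_hom_unitary_rep.
by rewrite (gz tt) fz.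
Qed.

(** Each symmetry [s i] gives a map on the [i]-th copy of [A], and the coproduct glues these
    maps. *)
Lemma cstar_free_product_symmetries (I : Type) A (a : A) E
    (iota : I -> A -> E) :
  universal_symmetries (fun _ : unit => a) ->
  cstar_free_product (fun _ : I => A) iota ->
  universal_symmetries (fun i => iota i a).
Proof.
move=> ha [hiota hE]; split=> [i|B s hs].
  exact/star_hom_symmetry/(proj1 ha tt).
have hf_ex i : exists f : A -> B, unital_star_hom f /\ f a = s i.
  have [f hf /(_ tt) fa] := universal_symmetries_hom ha (fun=> hs i).
  by exists f.
have [f hf] := choice hf_ex.
have [h [[hh hiot] hu]] := hE _ _ (fun i => proj1 (hf i)).
exists h; split=> [|g [hg ga]].
  by split=> // i; rewrite hiot (proj2 (hf i)).
apply: hu; split=> // i b; have [hfi fa] := hf i.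
(* Uniqueness is checked copy by copy: [g \o iota i] and [f i] agree at the universal symmetry
   [a]. *)
rewrite -[LHS]/((g \o iota i) b); congr (_ b).
apply: (universal_symmetries_ext ha) => // [|_]; last by rewrite /= ga fa.
exact: unital_star_hom_comp.
Qed.

Lemma free_group_unitary_rep (I : Type) (F : groupType) (x : I -> F) B
    (y : I -> B) :
  free_group_on x -> (forall i, cstar_unitary (y i)) ->
  exists2 v : F -> B, unitary_rep v & forall i, v (x i) = y i.
Proof.
move=> hF hy.
have [f [[fM fx] _]] := hF _ (fun i => to_unitary (hy i)).
(* [group_hom] records multiplicativity only; the unit is recovered by cancellation. *)
have f1 : f 1%g = 1%g by apply: (mulgI (f 1%g)); rewrite -fM !mulg1.
exists (fun g => val (f g)) => [|i]; last by rewrite fx.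
split=> [g||g h]; first exact: unitary_groupP.
  by rewrite f1.
by rewrite fM.
Qed.

(** Both representations corestrict to homomorphisms into [unitary_group B], where uniqueness for
    the free group applies. *)
Lemma free_group_unitary_rep_ext (I : Type) (F : groupType) (x : I -> F) B
    (v w : F -> B) :
  free_group_on x -> unitary_rep v -> unitary_rep w ->
  (forall i, v (x i) = w (x i)) -> v =1 w.
Proof.
move=> hF [vU _ vM] [wU _ wM] vw g.
have [f [_ fu]] := hF _ (fun i => to_unitary (wU (x i))).
have fv : f = (fun g => to_unitary (vU g)).
  by apply: fu; split=> [a b|i]; apply: val_inj; rewrite /= ?vM ?vw.
have fw : f = (fun g => to_unitary (wU g)).
  by apply: fu; split=> [a b|i]; apply: val_inj; rewrite /= ?wM.
exact: (congr1 (fun h : F -> unitary_group B => val (h g))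
  (etrans (esym fv) fw)).
Qed.

(** A symmetry is its own inverse, so this is conjugation by a unitary. *)
Lemma unitary_rep_conj (G : groupType) A (v : G -> A) (s : A) :
  symmetry s -> unitary_rep v -> unitary_rep (fun g => s * v g * s).
Proof.
move=> hs [vU v1 vM]; have [_ ss] := hs.
have hu := symmetry_unitary hs.
split=> [g||g h].
- by apply: cstar_unitaryM => //; exact: cstar_unitaryM.
- by rewrite v1 mulr1 ss.
- by rewrite vM !mulrA -(mulrA (s * v g) s) ss mulr1.
Qed.

Lemma unital_star_hom_conj A B (f : A -> B) (s : B) :
  symmetry s -> unital_star_hom f -> unital_star_hom (fun a => s * f a * s).
Proof.
move=> [sS ss] hf; split=> [k a b||a b|a].
- by rewrite (star_homD hf) (star_homZ hf) mulrDr mulrDl mulrZr mulrZl.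
- by rewrite (star_hom1 hf) mulr1.
- by rewrite (star_homM hf) !mulrA -(mulrA (s * f a) s) ss mulr1.
- by rewrite (star_hom_star hf) !star_mul sS mulrA.
Qed.

End Groups.

(** * The crossed product and its universal symmetries *)

Section CrossedProduct.
Variables (R : realType) (I : Type) (F : groupType) (x : I -> F).
Hypothesis hF : free_group_on x.
Variables (theta : F -> F) (CF : cstarAlgType R) (u : F -> CF).
Hypotheses (htheta : generator_inversion x theta) (hCF : full_group_cstar u).
Variable alpha : 'Z_2 -> CF -> CF.
Hypothesis halpha : induced_Z2_action u theta alpha.

Lemma theta_unitary_rep (B : cstarAlgType R) (v : F -> B) :
  unitary_rep v -> unitary_rep (v \o theta).
Proof.
move=> [vU v1 vM]; have [thetaM _ _] := htheta.
have theta1 : theta 1%g = 1%g.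
  by apply: (mulgI (theta 1%g)); rewrite -thetaM !mulg1.
by split=> [g||g h] /=; rewrite ?theta1 ?thetaM.
Qed.

(** Covariance at [Zp1] equates two star-homomorphisms on [CF]. It suffices to compare them on the
    unitaries [u g], hence on the free generators. *)
Lemma covariant_rep_symmetry (B : cstarAlgType R) (pi : CF -> B) (s : B) :
  unital_star_hom pi -> symmetry s ->
  (forall i, symmetry (pi (u (x i)) * s)) ->
  covariant_rep alpha pi (symmetry_rep s).
Proof.
move=> hpi hs hxs; have [sS ss] := hs; have [ru _] := hCF.
have [[alphaH alpha1 _] alphau] := halpha.
split=> //; first exact: symmetry_repP.
move=> g a; have [->|->] := Z2_cases g; rewrite /symmetry_rep.
  by rewrite eqxx star1 mul1r mulr1 alpha1.
rewrite /= sS.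
suff /(congr1 (@^~ a)) : (fun a => s * pi a * s) = pi \o alpha Zp1 by [].
apply: (full_group_cstar_ext hCF) => [||h].
- exact: unital_star_hom_conj.
- exact: unital_star_hom_comp.
rewrite /= alphau; move: h.
have rpi := star_hom_unitary_rep hpi ru.
apply: (free_group_unitary_rep_ext hF).
- exact: (unitary_rep_conj hs rpi).
- exact: (theta_unitary_rep rpi).
move=> i; have [_ _ ->] := htheta.
rewrite -[RHS]/((pi \o u) _) (unitary_repV _ rpi) /=.
(* With [y = pi (u (x i))], self-adjointness of [y * s] reads [s * star y = y * s], so
   [s * y * s = star y]. *)
have [xs _] := hxs i; move: xs; rewrite star_mul sS => xs.
by rewrite -mulrA -xs mulrA ss mul1r.
Qed.

Variables (E : cstarAlgType R) (jCF : CF -> E) (jZ2 : 'Z_2 -> E).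
Hypothesis hE : full_crossed_product alpha jCF jZ2.

(** [None] indexes the symmetry coming from Z/2, so [n - 1] generators yield [n] symmetries. *)
Definition crossed_product_symmetry (o : option I) : E :=
  if o is Some i then jCF (u (x i)) * jZ2 Zp1 else jZ2 Zp1.

(** For a generator [y] and [s = jZ2 Zp1], covariance gives [s * star y = y * s]. Hence [y * s] is
    self-adjoint, and its square is [s * star y * y * s = 1]. *)
Lemma crossed_product_symmetryP o : symmetry (crossed_product_symmetry o).
Proof.
have [[hj rj cov] _] := hE.
have hs := unitary_rep_symmetry rj; have [sS ss] := hs.
case: o => [i|] //=; set s := jZ2 Zp1 in hs sS ss *.
have [ru _] := hCF; have [_ alphau] := halpha; have [_ _ thetax] := htheta.
have rju := star_hom_unitary_rep hj ru.
have [/(_ (x i)) [/= xx _] _ _] := rju.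
have cov' : s * jCF (u (x i)) * s = star (jCF (u (x i))).
  have := cov Zp1 (u (x i)); rewrite -/s sS alphau thetax => ->.
  exact: (unitary_repV (x i) rju).
have xs : s * star (jCF (u (x i))) = jCF (u (x i)) * s.
  by rewrite -cov' !mulrA ss mul1r.
split; first by rewrite star_mul sS xs.
by rewrite -{1}xs mulrA -(mulrA s) xx mulr1.
Qed.

Lemma crossed_product_symmetries :
  universal_symmetries crossed_product_symmetry.
Proof.
split=> [|B s hs]; first exact: crossed_product_symmetryP.
have [[hj rj cov] hEu] := hE; have [ru hu] := hCF.
have [s0S s0s0] := hs None.
(* The generators go to [s (Some i) * s None], so that multiplying on the right by [s None] returns
   [s (Some i)]. *)
have hy i : cstar_unitary (s (Some i) * s None).
  by apply: cstar_unitaryM; exact: symmetry_unitary.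
have [v rv vx] := free_group_unitary_rep hF hy.
have [pi [[hpi piu] _]] := hu _ _ rv.
have pixs i : pi (u (x i)) * s None = s (Some i).
  by rewrite piu vx -mulrA s0s0 mulr1.
have hcov : covariant_rep alpha pi (symmetry_rep (s None)).
  by apply: covariant_rep_symmetry => // i; rewrite pixs.
have [f [[hf fj fz] fu]] := hEu _ _ _ hcov.
exists f; split=> [|g [hg gs]].
  split=> // -[i|] /=; last by rewrite fz.
  by rewrite (star_homM hf) fj fz pixs.
have g0 := gs None; rewrite /= in g0.
apply: fu; split=> //.
  (* On [CF], uniqueness reduces to the free generators, whose images are recovered from the
     symmetries by cancelling [s None]. *)
  move=> a; rewrite -[LHS]/((g \o jCF) a); congr (_ a).
  apply: (full_group_cstar_ext hCF) => //; first exact: unital_star_hom_comp.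
  apply: (free_group_unitary_rep_ext hF).
  - by apply: star_hom_unitary_rep ru; exact: unital_star_hom_comp.
  - exact: star_hom_unitary_rep.
  move=> i; rewrite piu vx /= -(gs (Some i)) /= (star_homM hg) g0.
  by rewrite -mulrA s0s0 mulr1.
apply: unitary_rep_Z2_ext => //.
- exact: star_hom_unitary_rep.
- exact: symmetry_repP.
Qed.

End CrossedProduct.

Theorem theorem2p1 (R : realType) (n : nat) (hn : (1 <= n)%N)
  (* the universal unital C*-algebra generated by n projections *)
  (A : cstarAlgType R) (P : 'I_n -> A) (hA : universal_projections P)
  (* the group C*-algebra of Z/2 and the free product of n copies of it *)
  (CZ2 : cstarAlgType R) (z : 'Z_2 -> CZ2) (hCZ2 : full_group_cstar z)
  (FP : cstarAlgType R) (iota : 'I_n -> CZ2 -> FP)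
  (hFP : cstar_free_product (fun _ : 'I_n => CZ2) iota)
  (* the free group on n - 1 generators and its generator-inverting
     automorphism *)
  (F : groupType) (x : 'I_n.-1 -> F) (hF : free_group_on x)
  (theta : F -> F) (htheta : generator_inversion x theta)
  (* its group C*-algebra, with the induced Z/2-action *)
  (CF : cstarAlgType R) (u : F -> CF) (hCF : full_group_cstar u)
  (alpha : 'Z_2 -> CF -> CF) (halpha : induced_Z2_action u theta alpha)
  (* the crossed product *)
  (E : cstarAlgType R) (jCF : CF -> E) (jZ2 : 'Z_2 -> E)
  (hE : full_crossed_product alpha jCF jZ2) :
  cstar_isomorphic A FP /\ cstar_isomorphic FP E.
Proof.
have hSA := universal_projections_symmetries hA.
have hSFP := cstar_free_product_symmetries
  (full_group_cstar_Z2_symmetry hCZ2) hFP.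
split; first exact: universal_symmetries_isomorphic hSA hSFP.
have hSE := crossed_product_symmetries hF htheta hCF halpha hE.
(* Since [n >= 1], index 0 exists. [unlift o] sends it to [None] and identifies the other indices
   with ['I_n.-1], matching the index type of [hSE]. *)
pose o : 'I_n := Ordinal hn.
have ob : bijective (unlift o).
  exists (oapp (lift o) o) => [i|[j|]] /=; last 2 first.
  - exact: liftK.
  - exact: unlift_none.
  by case: unliftP => [j ->|->].
exact: universal_symmetries_isomorphic hSFP
  (universal_symmetries_reindex ob hSE).
Qed.
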